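(* Let $p$ be a prime, let $K/\mathbb Q_p$ be a finite extension with ring of integers $\mathcal O_K$ and maximal ideal $\mathfrak m_K$, and fix an algebraic closure $\overline K$ of $K$. Let $f\in\mathcal O_K[X]$ be monic of degree at least $2$ with $f(X)\equiv X^q\pmod{\mathfrak m_K}$, where $q=p^a$ and $a\geq 1$. Let $t_0\in\mathcal O_K$, and let $(t_n)_{n\geq 0}$ be a sequence in $\overline K$ with $f(t_{n+1})=t_n$ for all $n\geq 0$. If $K_n=K(t_n)$ is unramified over $K$ for every $n$, then $t_n\in K$ for every $n$. Consequently $K_\infty:=\bigcup_{n\geq 0}K_n$ equals $K$.
   Context: The congruence $f(X)\equiv X^q\pmod{\mathfrak m_K}$ is coefficientwise, i.e. $f(X)-X^q\in\mathfrak m_K\mathcal O_K[X]$; it implies $f'(X)\in\mathfrak m_K\mathcal O_K[X]$. *)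

(* Defs.v *)
From HB Require Import structures.
From mathcomp Require Import all_boot all_order all_algebra all_field.
From mathcomp Require Import boolp classical_sets.
Set Implicit Arguments.
Unset Strict Implicit.
Unset Printing Implicit Defensive.

Import GRing.Theory.
Local Open Scope ring_scope.
Local Open Scope classical_set_scope.

(* Z_p is the inverse limit of the rings Z/p^(n+1), n >= 0. The casts go      *)
(* through nat: (residue x n.+1)%:R is the image of residue x n.+1 under the  *)
(* reduction map 'Z_(p ^ n.+2) -> 'Z_(p ^ n.+1).                              *)
Record padic_int (p : nat) (p_pr : prime p) := PadicInt {
  residue :> forall n : nat, 'Z_(p ^ n.+1);
  residue_compat : forall n : nat, (residue n.+1)%:R = residue n
}.

Section PadicInt.
Variables (p : nat) (p_pr : prime p).
Local Notation Zp := (padic_int p_pr).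
Implicit Types x y z : Zp.

Lemma pexp_gt1 n : (1 < p ^ n.+1)%N.
Proof. by rewrite (ltn_exp2l 0) ?prime_gt1. Qed.

Lemma padic_int_ext x y : (forall n, x n = y n) -> x = y.
Proof.
case: x y => [x xP] [y yP] /= xy.
have E : x = y by apply: functional_extensionality_dep.
by subst y; congr PadicInt; apply: Prop_irrelevance.
Qed.

Lemma natr_modZ m d k : (1 < d)%N -> (d %| m)%N ->
  ((k %% m)%N)%:R = k%:R :> 'Z_d.
Proof.
by move=> d1 /dvdnP[e ->]; rewrite [in RHS](divn_eq k (e * d)) natrD !natrM
  pchar_Zp // !mulr0 add0r.
Qed.

Let red n (a : 'Z_(p ^ n.+2)) : 'Z_(p ^ n.+1) := (a : nat)%:R.

Let red_nat n k : red (k%:R : 'Z_(p ^ n.+2)) = k%:R.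
Proof.
by rewrite /red val_Zp_nat ?pexp_gt1 // natr_modZ ?pexp_gt1 // dvdn_exp2l.
Qed.

Let redD n (a b : 'Z_(p ^ n.+2)) : red (a + b) = red a + red b.
Proof. by rewrite -[a]natr_Zp -[b]natr_Zp -natrD !red_nat natrD. Qed.

Let redM n (a b : 'Z_(p ^ n.+2)) : red (a * b) = red a * red b.
Proof. by rewrite -[a]natr_Zp -[b]natr_Zp -natrM !red_nat natrM. Qed.

Let redN n (a : 'Z_(p ^ n.+2)) : red (- a) = - red a.
Proof.
by apply/eqP; rewrite -subr_eq0 opprK -redD addNr (red_nat n 0).
Qed.

Fact zero_compat n : ((0 : 'Z_(p ^ n.+2))%R : nat)%:R = 0 :> 'Z_(p ^ n.+1).
Proof. exact: (red_nat n 0). Qed.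

Fact one_compat n : ((1 : 'Z_(p ^ n.+2))%R : nat)%:R = 1 :> 'Z_(p ^ n.+1).
Proof. exact: (red_nat n 1). Qed.

Fact opp_compat x n :
  ((- x n.+1 : 'Z_(p ^ n.+2))%R : nat)%:R = - x n :> 'Z_(p ^ n.+1).
Proof. by rewrite -[LHS]/(red _) redN /red residue_compat. Qed.

Fact add_compat x y n :
  ((x n.+1 + y n.+1 : 'Z_(p ^ n.+2))%R : nat)%:R = x n + y n :> 'Z_(p ^ n.+1).
Proof. by rewrite -[LHS]/(red _) redD /red !residue_compat. Qed.

Fact mul_compat x y n :
  ((x n.+1 * y n.+1 : 'Z_(p ^ n.+2))%R : nat)%:R = x n * y n :> 'Z_(p ^ n.+1).
Proof. by rewrite -[LHS]/(red _) redM /red !residue_compat. Qed.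

Definition padic_zero : Zp := PadicInt p_pr zero_compat.
Definition padic_one : Zp := PadicInt p_pr one_compat.
Definition padic_opp x : Zp := PadicInt p_pr (opp_compat x).
Definition padic_add x y : Zp := PadicInt p_pr (add_compat x y).
Definition padic_mul x y : Zp := PadicInt p_pr (mul_compat x y).

HB.instance Definition _ := gen_eqMixin Zp.
HB.instance Definition _ := gen_choiceMixin Zp.

Fact padic_addA : associative padic_add.
Proof. by move=> x y z; apply: padic_int_ext => n; apply: addrA. Qed.
Fact padic_addC : commutative padic_add.
Proof. by move=> x y; apply: padic_int_ext => n; apply: addrC. Qed.
Fact padic_add0 : left_id padic_zero padic_add.
Proof. by move=> x; apply: padic_int_ext => n; apply: add0r. Qed.
Fact padic_addN : left_inverse padic_zero padic_opp padic_add.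
Proof. by move=> x; apply: padic_int_ext => n; apply: addNr. Qed.
HB.instance Definition _ := GRing.isZmodule.Build Zp
  padic_addA padic_addC padic_add0 padic_addN.

Fact padic_mulA : associative padic_mul.
Proof. by move=> x y z; apply: padic_int_ext => n; apply: mulrA. Qed.
Fact padic_mulC : commutative padic_mul.
Proof. by move=> x y; apply: padic_int_ext => n; apply: mulrC. Qed.
Fact padic_mul1 : left_id padic_one padic_mul.
Proof. by move=> x; apply: padic_int_ext => n; apply: mul1r. Qed.
Fact padic_mulD : left_distributive padic_mul padic_add.
Proof. by move=> x y z; apply: padic_int_ext => n; apply: mulrDl. Qed.
Fact padic_oner_neq0 : padic_one != 0.
Proof.
apply/eqP => /(congr1 (fun x : Zp => x 0)) /eqP.
by rewrite /= (oner_eq0 'Z_(p ^ 1)).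
Qed.
HB.instance Definition _ := GRing.Zmodule_isComNzRing.Build Zp
  padic_mulA padic_mulC padic_mul1 padic_mulD padic_oner_neq0.

Definition padic_unit : {pred Zp} := fun x => `[< exists y, y * x = 1 >].
Definition padic_inv x : Zp :=
  if pselect (exists y, y * x = 1) is left e then sval (cid e) else x.

Fact padic_mulVx : {in padic_unit, left_inverse 1 padic_inv *%R}.
Proof.
move=> x /asboolP xU; rewrite /padic_inv.
by case: pselect => // e; case: cid.
Qed.
Fact padic_unitPl x y : y * x = 1 -> padic_unit x.
Proof. by move=> yx; apply/asboolP; exists y. Qed.
Fact padic_inv_out : {in [predC padic_unit], padic_inv =1 id}.
Proof.
move=> x /asboolP xU; rewrite /padic_inv.
by case: pselect.
Qed.
HB.instance Definition _ := GRing.ComNzRing_hasMulInverse.Build Zp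
  padic_mulVx padic_unitPl padic_inv_out.

Lemma residue_natr x n k : ((x (n + k)%N : nat)%:R : 'Z_(p ^ n.+1)) = x n.
Proof.
elim: k => [|k IHk]; first by rewrite addn0 natr_Zp.
rewrite addnS -IHk -(residue_compat x (n + k)) val_Zp_nat ?pexp_gt1 //.
by rewrite natr_modZ ?pexp_gt1 // dvdn_exp2l // ltnS leq_addr.
Qed.

Lemma natrZ_eq0 n k : ((k%:R : 'Z_(p ^ n.+1)) == 0) = (p ^ n.+1 %| k)%N.
Proof. by rewrite -val_eqE /= val_Zp_nat ?pexp_gt1. Qed.

Fact padic_integral : GRing.integral_domain_axiom Zp.
Proof.
move=> x y xy0; apply: contrapT => /negP; rewrite negb_or => /andP[x0 y0].
have nz z : z != 0 -> exists n, z n != 0.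
  move=> z0; apply: contrapT => /forallNP zn0.
  move/eqP: z0; apply; apply: padic_int_ext => n.
  by apply/eqP; apply: contrapT => /negP /(zn0 n).
have [n xn] := nz x x0; have [m ym] := nz y y0.
rewrite -(residue_natr x n m.+1) natrZ_eq0 in xn.
rewrite -(residue_natr y m n.+1) natrZ_eq0 addnS addnC -addnS in ym.
move: xn ym; set a : nat := x _; set b : nat := y _ => pa pb.
have pab : (p ^ (n + m.+1).+1 %| a * b)%N.
  rewrite -natrZ_eq0 natrM !natr_Zp; apply/eqP.
  exact: (congr1 (fun z : Zp => z (n + m.+1)%N) xy0).
have a0 : (0 < a)%N by case: (a) pa => //; rewrite dvdn0.
have b0 : (0 < b)%N by case: (b) pb => //; rewrite dvdn0.
move: pa pb pab; rewrite !pfactor_dvdn ?muln_gt0 ?a0 ?b0 // lognM // -!leqNgt.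
move=> la lb; rewrite leqNgt ltnS (leq_trans (leq_add la lb)) //.
by rewrite leq_add2l.
Qed.
HB.instance Definition _ := GRing.ComUnitRing_isIntegral.Build Zp padic_integral.

End PadicInt.

Definition padic (p : nat) (p_pr : prime p) : fieldType :=
  {fraction padic_int p_pr}.

Definition padic_int_in (p : nat) (p_pr : prime p)
    (K : fieldExtType (padic p_pr)) (a : padic_int p_pr) : K :=
  (FracField.tofrac a : padic p_pr)%:A.

Section PadicIntIn.
Variables (p : nat) (p_pr : prime p) (K : fieldExtType (padic p_pr)).

Fact padic_int_in_zmod_morphism : zmod_morphism (@padic_int_in p p_pr K).
Proof.
by move=> x y; rewrite /padic_int_in (rmorphB (@FracField.tofrac _)) scalerBl.
Qed.
Fact padic_int_in_monoid_morphism : monoid_morphism (@padic_int_in p p_pr K).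
Proof.
split=> [|x y]; rewrite /padic_int_in.
  by rewrite (rmorph1 (@FracField.tofrac _)) scale1r.
by rewrite (rmorphM (@FracField.tofrac _)) -scalerAl mul1r scalerA.
Qed.
HB.instance Definition _ := GRing.isZmodMorphism.Build _ _
  (@padic_int_in p p_pr K) padic_int_in_zmod_morphism.
HB.instance Definition _ := GRing.isMonoidMorphism.Build _ _
  (@padic_int_in p p_pr K) padic_int_in_monoid_morphism.

End PadicIntIn.

(* Ring of integers of a subfield L of an extension E of Q_p: the integral    *)
(* closure of Z_p in L, where Zp_in : Z_p -> E is the structure map.          *)
Definition ring_of_integers (Zp E : nzRingType) (Zp_in : Zp -> E)
    (L : set E) : set E :=
  [set x | L x /\ integralOver Zp_in x].

(* The maximal ideal of a local ring O is the set of its nonunits; rings of   *)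
(* integers of algebraic extensions of Q_p are local.                         *)
Definition max_ideal (E : nzRingType) (O : set E) : set E :=
  [set x | O x /\ ~ (exists2 y, O y & x * y = 1)].

(* The ideal of the subring O generated by the subset I.                      *)
Definition ideal_span (E : nzRingType) (O I : set E) : set E :=
  [set x | exists (n : nat) (a b : 'I_n -> E),
    [/\ forall i, I (a i), forall i, O (b i) & x = \sum_(i < n) a i * b i]].

(* K(t): the smallest subfield of E containing the image of K and t.          *)
Definition adjoin (K E : fieldType) (iota : K -> E) (t : E) : set E :=
  [set x | forall S : {pred E}, divring_closed S ->
    (forall a : K, iota a \in S) -> t \in S -> x \in S].

Section Extensions.
Variables (p : nat) (p_pr : prime p) (K : fieldExtType (padic p_pr)).

Definition OK : set K := ring_of_integers (@padic_int_in p p_pr K) setT.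
Definition mK : set K := max_ideal OK.

Variables (E : fieldType) (iota : K -> E).

Definition OL (L : set E) : set E :=
  ring_of_integers (iota \o @padic_int_in p p_pr K) L.
Definition mL (L : set E) : set E := max_ideal (OL L).

(* The finite extension L / K has ramification index 1: m_L = m_K O_L. The    *)
(* residue fields are finite, so the residue extension is always separable.   *)
Definition unramified (L : set E) : Prop :=
  mL L = ideal_span (OL L) (iota @` mK).

End Extensions.
Arguments OK {p p_pr} K.
Arguments mK {p p_pr} K.

Definition is_algebraic_closure (K : fieldType) (Kbar : closedFieldType)
    (iota : {rmorphism K -> Kbar}) : Prop :=
  forall x : Kbar, algebraicOver iota x.

(* Main.v *)
Require Import Defs.
From HB Require Import structures.
From mathcomp Require Import all_boot all_order all_algebra all_field.
From mathcomp Require Import ring.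
From mathcomp Require Import boolp classical_sets.

Import GRing.Theory.
Local Open Scope ring_scope.
Local Open Scope classical_set_scope.
Set Implicit Arguments.
Unset Strict Implicit.
Unset Printing Implicit Defensive.

(* Every t_n is congruent to an element of O_K modulo m_K: its q^n-th power is
   congruent to t_0, the residue of t_0 is a q^n-th power since it is algebraic
   over F_p, and K_n is unramified. As f' = 0 mod m_K, applying f turns a
   congruence modulo c^k into one modulo c^(k+1), for c in m_K dividing p and
   the coefficients of f - X^q. Going down from t_(n+k) to t_n, and using that
   p divides c^[K:Q_p], one finds t_n in K + p^j O for every j, where O is the
   ring of integers of Kbar. All conjugates of t_n have the same approximations
   in K, so t_n is its only conjugate and lies in K.

   No Hensel lemma is used: that the nonunits of O_K are closed under addition
   is part of the hypothesis that K_0 = K is unramified. A local integral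
   closure of Z_p in K is a valuation ring. *)

(** * Divisibility by p and inverses modulo p in Z_p *)

Section PadicIntegers.
Variables (p : nat) (p_pr : prime p).
Local Notation Zp := (padic_int p_pr).
Implicit Types (x y : Zp) (n m : nat).

Lemma residueD x y n : (x + y) n = x n + y n. Proof. by []. Qed.
Lemma residueM x y n : (x * y) n = x n * y n. Proof. by []. Qed.
Lemma residueN x n : (- x) n = - x n. Proof. by []. Qed.

Lemma residue_nat m n : (m%:R : Zp) n = m%:R.
Proof. by elim: m => [//|m IHm]; rewrite !mulrS residueD IHm. Qed.

Lemma natp_residue0 : (p%:R : Zp) 0 = 0.
Proof. by rewrite residue_nat; apply/eqP; rewrite natrZ_eq0 // expn1. Qed.

Lemma natr_padic_neq0 m : m != 0 -> m%:R != 0 :> Zp.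
Proof.
rewrite -lt0n => m_gt0; apply/eqP => /(congr1 (fun z : Zp => z m)).
rewrite residue_nat => /eqP; rewrite natrZ_eq0 // => /(dvdn_leq m_gt0).
by rewrite leqNgt (ltn_trans (ltnSn m)) // ltn_expl ?prime_gt1.
Qed.

Lemma natp_neq0 : p%:R != 0 :> Zp.
Proof. by rewrite natr_padic_neq0 // -lt0n prime_gt0. Qed.

Lemma residue0_dvdp x : x 0 = 0 -> exists y, x = p%:R * y.
Proof.
move=> x0.
have p_dvd n : (p %| (x n : nat))%N.
  have := residue_natr x 0 n; rewrite x0 add0n => /eqP.
  by rewrite natrZ_eq0 // expn1.
(* Division by p costs one level of precision: level n of the quotient is read off from level n+1 of
   [x]. *)
have y_compat n : (((((x n.+2 : nat) %/ p)%:R : 'Z_(p ^ n.+2)) : nat))%:R =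
    ((x n.+1 : nat) %/ p)%:R :> 'Z_(p ^ n.+1).
  have p1 := pexp_gt1 p_pr.
  rewrite val_Zp_nat // natr_modZ ?dvdn_exp2l //.
  rewrite -(residue_compat x n.+1) val_Zp_nat //.
  set A : nat := x n.+2.
  (* The top part of [A] adds a multiple of p^(n+1) to the quotient by p, which vanishes at level
     n. *)
  have {1}-> : A = (A %/ p ^ n.+2 * p ^ n.+1 * p + A %% p ^ n.+2)%N.
    by rewrite -mulnA -expnSr -divn_eq.
  rewrite divnMDl ?prime_gt0 // natrD natrM -[X in _ * X]natr_Zp.
  rewrite val_Zp_nat // modnn mulr0 add0r //.
exists (PadicInt p_pr y_compat); apply: padic_int_ext => n.
rewrite residueM residue_nat /= -natrM mulnC divnK ?p_dvd //.
by rewrite residue_compat.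
Qed.

(** A Bezout coefficient of the residue serves as [v]. This inverse modulo p takes the place of an
    actual inverse in Z_p. *)
Lemma residue_mul1_modp x : x 0 != 0 -> exists v w, v * x = 1 + p%:R * w.
Proof.
move=> x0; pose a : nat := x 0; pose v : Zp := (egcdn a p).1%:R.
have co_ap : coprime a p.
  rewrite coprime_sym prime_coprime //; apply: contra x0.
  by rewrite -(natr_Zp (x 0)) natrZ_eq0 // expn1.
have a_gt0 : (0 < a)%N.
  by move: co_ap; rewrite /coprime; case: (a) => //; rewrite gcd0n => /eqP p1;
    move: p_pr; rewrite p1.
have vx1 : (v * x - 1) 0 = 0.
  rewrite residueD residueM residue_nat -(natr_Zp (x 0)) residueN -natrM.
  case: egcdnP => //= km kn Ekm _; rewrite Ekm (eqP co_ap) natrD natrM.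
  by rewrite -(residue_nat p) natp_residue0 mulr0 add0r subrr.
by have [w Ew] := residue0_dvdp vx1; exists v, w; rewrite -Ew addrC subrK.
Qed.

(** Induction on a level where [x] has nonzero residue: removing a factor p lowers that level by
    one. *)
Lemma residue_factor x : x != 0 -> exists k u, x = p%:R ^+ k * u /\ u 0 != 0.
Proof.
move=> x_neq0.
have [n xn] : exists n, x n != 0.
  apply: contrapT => /forallNP x0; case/eqP: x_neq0; apply: padic_int_ext => n.
  by apply/eqP; apply: contrapT => /negP; apply: x0.
elim: n x {x_neq0} xn => [|n IHn] x xn; first by exists 0, x; rewrite mul1r.
have [/residue0_dvdp[y Exy] | ] := eqVneq (x 0) 0; last first.
  by exists 0, x; rewrite mul1r.
have [|k [u [Ey u0]]] := IHn y; last first.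
  by exists k.+1, u; rewrite Exy Ey exprS mulrA.
apply: contra xn; rewrite Exy residueM residue_nat => /eqP yn.
have := residue_natr y n 1; rewrite addn1 yn => /eqP.
rewrite natrZ_eq0 // => p_dvd; rewrite -(natr_Zp (y n.+1)) -natrM.
rewrite natrZ_eq0 //; move: p_dvd; set b : nat := y n.+1.
by rewrite [(p ^ n.+2)%N]expnS dvdn_pmul2l ?prime_gt0.
Qed.

End PadicIntegers.

(** * Integral closures in a field: monic relations and Taylor expansion *)

Section IntegralClosure.
Variables (R : comNzRingType) (F : fieldType) (h : {rmorphism R -> F}).

Definition integral_closure : {pred F} := fun x => `[< integralOver h x >].

Lemma integral_closureP x : reflect (integralOver h x) (x \in integral_closure).
Proof. exact: asboolP. Qed.

Fact integral_closure_subring : subring_closed integral_closure.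
Proof.
split=> [|x y /asboolP xI /asboolP yI|x y /asboolP xI /asboolP yI].
- exact/asboolP/integral1.
- exact/asboolP/integral_sub.
- exact/asboolP/integral_mul.
Qed.
HB.instance Definition _ := GRing.isSubringClosed.Build F integral_closure
  integral_closure_subring.

Lemma integral_closure_id x : h x \in integral_closure.
Proof. exact/asboolP/integral_id. Qed.

Lemma integral_closure_root (P : {poly F}) x :
  P \is monic -> root P x -> (forall i, P`_i \in integral_closure) ->
  x \in integral_closure.
Proof.
move=> Pm Px PI; apply/asboolP/(integral_root_monic Pm Px)/integral_poly => i.
exact/asboolP/PI.
Qed.

Lemma integral_closure_horner (P : {poly F}) x :
  (forall i, P`_i \in integral_closure) -> x \in integral_closure ->
  P.[x] \in integral_closure.
Proof.
move=> PI xI; rewrite horner_coef rpred_sum // => i _.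
by rewrite rpredM ?rpredX.
Qed.

(** Multiplying the relation by b^n turns it into a monic equation for b z, with lower coefficients
    L_i b^(n-i). *)
Lemma integral_closure_dominant n b z (L : {poly F}) :
  b \in integral_closure -> (forall i, L`_i \in integral_closure) ->
  (size L <= n.+1)%N -> b * z ^+ n.+1 + L.[z] = 0 ->
  b * z \in integral_closure.
Proof.
move=> bO LO sL bz; pose M : {poly F} := \poly_(i < n.+1) (L`_i * b ^+ (n - i)).
have sM : (size M < size ('X^(n.+1) : {poly F}))%N.
  by rewrite size_polyXn ltnS size_poly.
apply: (@integral_closure_root ('X^(n.+1) + M)).
- by rewrite monicE lead_coefDl // lead_coefXn.
- apply/eqP; rewrite hornerD hornerXn horner_poly.
  rewrite (eq_bigr (fun i : 'I_n.+1 => b ^+ n * (L`_i * z ^+ i))); last first.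
    move=> i _; have -> : b ^+ n = b ^+ (n - i) * b ^+ i.
      by rewrite -exprD subnK // -ltnS.
    by rewrite exprMn [_ * b ^+ (n - i)]mulrC mulrACA.
  rewrite -mulr_sumr -horner_poly exprMn exprSr -mulrA -mulrDr.
  have -> : \poly_(i < n.+1) L`_i = L.
    apply/polyP => i; rewrite coef_poly; case: ltnP => // ni.
    by rewrite nth_default // (leq_trans sL).
  by rewrite bz mulr0.
- move=> i; rewrite coefD coefXn coef_poly rpredD ?rpred_nat //.
  by case: ifP => _; rewrite ?rpred0 ?rpredM ?rpredX.
Qed.

Lemma integral_closure_lead_coef (P : {poly F}) z :
  (forall i, P`_i \in integral_closure) -> root P z ->
  lead_coef P * z \in integral_closure.
Proof.
move=> PO /eqP Pz; rewrite lead_coefE; case sP: (size P) => [|[|n]] /=.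
- by rewrite nth_default ?sP // mul0r rpred0.
- have /size1_polyC PE : (size P <= 1)%N by rewrite sP.
  by move: Pz; rewrite PE hornerC coefC /= => ->; rewrite mul0r rpred0.
apply: (@integral_closure_dominant n _ _ (take_poly n.+1 P)) => //.
- by move=> i; rewrite coef_take_poly; case: ifP => _; rewrite ?rpred0.
- exact: size_take_poly.
rewrite -[RHS]Pz -{3}(poly_take_drop n.+1 P) hornerD hornerM hornerXn addrC.
congr (_ + _ * _).
rewrite [drop_poly _ _]size1_polyC ?hornerC ?coef_drop_poly //.
by rewrite size_drop_poly sP subSnn.
Qed.

(** Building P by Horner's scheme yields the quadratic remainder without dividing by 2, hence with
    an integral factor. *)
Lemma integral_closure_taylor (P : {poly F}) x d :
  (forall i, P`_i \in integral_closure) ->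
  x \in integral_closure -> d \in integral_closure ->
  exists2 w, w \in integral_closure &
    P.[x + d] = P.[x] + P^`().[x] * d + w * d ^+ 2.
Proof.
move=> PO xO dO; elim/poly_ind: P PO => [|P c IHP] PO.
  by exists 0; rewrite ?rpred0 // deriv0 !horner0 !mul0r !addr0.
have {}PO i : P`_i \in integral_closure.
  by have := PO i.+1; rewrite coefD coefMX coefC addr0.
have [w wO wE] := IHP PO; exists (P^`().[x] + w * (x + d)).
  rewrite rpredD ?rpredM ?rpredD // integral_closure_horner // => i.
  by rewrite coef_deriv rpredMn.
rewrite derivD derivM derivX derivC addr0 mulr1.
rewrite !(hornerD, hornerM, hornerX, hornerC) wE.
by ring.
Qed.

End IntegralClosure.

(** * Integrality over Z_p and primitive annihilating polynomials *)

Section IntegralClosureOfPadicIntegers.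
Variables (p : nat) (p_pr : prime p).
Local Notation Zp := (padic_int p_pr).

Lemma natp_image_neq0 (F : fieldType) (h : {rmorphism Zp -> F}) :
  injective h -> p%:R != 0 :> F.
Proof.
move=> h_inj; rewrite -(rmorph_nat h) -(rmorph0 h) (inj_eq h_inj).
exact: natp_neq0.
Qed.

(** Multiplied by p^n, a monic equation of degree n for 1/p becomes an identity in Z_p that reads 1
    = 0 modulo p. *)
Lemma natp_inv_nonintegral (F : fieldType) (h : {rmorphism Zp -> F}) :
  injective h -> p%:R^-1 \notin integral_closure h.
Proof.
move=> h_inj; apply/negP => /asboolP[P Pm].
have p_neq0 := natp_image_neq0 h_inj.
pose n := (size P).-1; have sP : size P = n.+1.
  by rewrite prednK // lt0n size_poly_eq0 monic_neq0.
rewrite /root horner_coef size_map_poly_id0; last first.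
  by rewrite (monicP Pm) rmorph1 oner_eq0.
rewrite sP => /eqP /(congr1 (fun z => z * p%:R ^+ n)).
rewrite mul0r mulr_suml => PpE.
have: h (\sum_(i < n.+1) P`_i * p%:R ^+ (n - i)) = h 0.
  rewrite rmorph0 -[RHS]PpE rmorph_sum; apply: eq_bigr => i _ /=.
  rewrite coef_map rmorphM rmorphXn rmorph_nat /= -mulrA; congr (_ * _).
  rewrite [LHS]expfB_cond; last by rewrite (negPf p_neq0) -ltnS ltn_ord.
  by rewrite exprVn mulrC.
move/h_inj; rewrite big_ord_recr /= subnn mulr1.
have -> : P`_n = 1 by have := monicP Pm; rewrite lead_coefE.
rewrite (eq_bigr (fun i : 'I_n => p%:R * (P`_i * p%:R ^+ (n - i.+1)))) =>
  [|i _].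
  rewrite -mulr_sumr => /(congr1 (fun z : Zp => z 0)).
  rewrite residueD residueM natp_residue0 mul0r add0r => /eqP.
  by rewrite (oner_eq0 'Z_(p ^ 1)).
by rewrite [RHS]mulrCA -exprS subnSK.
Qed.

(** Factors p are removed while all coefficients vanish modulo p; the valuation of the leading
    coefficient bounds the number of rounds. *)
Lemma primitive_factor (P : {poly Zp}) : P != 0 ->
  exists (k : nat) (P1 : {poly Zp}),
    P = p%:R ^+ k *: P1 /\ exists i, P1`_i 0 != 0.
Proof.
move=> P_neq0; have: lead_coef P != 0 by rewrite lead_coef_eq0.
rewrite lead_coefE; move: (_.-1) => i {P_neq0} /residue_factor[k [u [Pi u0]]].
elim: k P Pi => [|k IHk] P Pi.
  by exists 0, P; split; [rewrite scale1r | exists i; rewrite Pi mul1r].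
have [[j Pj]|/forallNP Pp] := pselect (exists j, P`_j 0 != 0).
  by exists 0, P; split; [rewrite scale1r | exists j].
have Pdiv j : exists y, P`_j = p%:R * y.
  by apply/residue0_dvdp/eqP; apply: contrapT => /negP /Pp.
pose Q := \poly_(j < size P) sval (cid (Pdiv j)).
have PE : P = p%:R *: Q.
  apply/polyP => j; rewrite coefZ coef_poly.
  case: ltnP => [_|/(nth_default 0)->].
    by case: cid.
  by rewrite mulr0.
have [|m [P1 [QE P1i]]] := IHk Q.
  apply: (mulfI (natp_neq0 p_pr)); rewrite -coefZ -PE Pi exprS mulrA.
  by [].
by exists m.+1, P1; rewrite PE QE scalerA exprS.
Qed.

Lemma fraction_repr (R : idomainType) (c : {fraction R}) :
  exists d n : R, d != 0 /\ FracField.tofrac d * c = FracField.tofrac n.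
Proof.
elim/quotW: c => r; exists \d_r, \n_r; split; first exact: denom_ratioP.
rewrite -[_ * _]/(FracField.mul _ _) !piE.
apply/eqmodP; rewrite /= FracField.equivfE /FracField.mulf.
rewrite !numden_Ratio ?(oner_eq0, mulf_neq0, denom_ratioP) //.
by rewrite !mulr1 mul1r.
Qed.

Lemma fraction_poly_repr (R : idomainType) (P : {poly {fraction R}}) :
  exists (d : R) (Q : {poly R}),
    d != 0 /\ map_poly (@FracField.tofrac R) Q = FracField.tofrac d *: P.
Proof.
elim/poly_ind: P => [|P c [d [Q [d0 QE]]]].
  by exists 1, 0; rewrite oner_eq0 rmorph0 scaler0.
have [b [n [b0 nE]]] := fraction_repr c.
exists (b * d), ((b *: Q) * 'X + (d * n)%:P); rewrite mulf_neq0 //; split=> //.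
rewrite rmorphD rmorphM /= map_polyZ QE map_polyX map_polyC /= scalerDr.
rewrite !rmorphM /= -nE scalerA -scalerAl. congr (_ + _).
by rewrite -mul_polyC -!polyCM mulrCA mulrA.
Qed.

Variable K : fieldExtType (padic p_pr).
Local Notation Zp_in := (@padic_int_in p p_pr K).

Lemma padic_int_in_inj : injective Zp_in.
Proof.
move=> x y /(fmorph_inj (in_alg K)) /eqP.
by rewrite tofrac_eq => /eqP.
Qed.

(** Clear denominators in the minimal polynomial of [c] over Q_p, then remove the powers of p. The
    result need not be monic, so it also serves nonintegral [c]. *)
Lemma primitive_annihilator (c : K) :
  exists P : {poly Zp}, [/\ (size P <= (\dim {:K}).+1)%N,
    root (map_poly Zp_in P) c & exists i, P`_i 0 != 0].
Proof.
have /polyOver1P[g gE] := minPolyOver 1%AS c.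
have [d [Q [d0 QE]]] := fraction_poly_repr g.
have sg : size g = size (minPoly 1%AS c) by rewrite gE size_map_poly.
have tofrac_inj : injective (@FracField.tofrac Zp).
  by move=> x y /eqP; rewrite tofrac_eq => /eqP.
have sQ : size Q = size (minPoly 1%AS c).
  rewrite -sg -(size_map_inj_poly tofrac_inj (rmorph0 _)) QE size_scale //.
  by rewrite tofrac_eq0.
have Q0 : Q != 0 by rewrite -size_poly_eq0 sQ size_minPoly.
have [k [P [QP P1]]] := primitive_factor Q0; exists P; split=> //.
- rewrite -(size_scale _ (expf_neq0 k (natp_neq0 p_pr))) -QP sQ.
  rewrite size_minPoly ltnS.
  rewrite /adjoin_degree dimv1 divn1 prednK ?dimvS ?subvf //.
  exact: adim_gt0.
- have: root (map_poly Zp_in Q) c.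
    have -> : map_poly Zp_in Q =
        map_poly (in_alg K) (map_poly (@FracField.tofrac Zp) Q).
      by rewrite -map_poly_comp.
    rewrite QE map_polyZ -gE rootZ ?root_minPoly //.
    by rewrite fmorph_eq0 tofrac_eq0.
  rewrite QP map_polyZ rootZ // rmorphXn rmorph_nat expf_neq0 //.
  exact: natp_image_neq0 padic_int_in_inj.
Qed.
End IntegralClosureOfPadicIntegers.

(** * The p-power map is additive modulo p on integral elements *)

Section Frobenius.
Variables (R : comNzRingType) (F : fieldType) (h : {rmorphism R -> F}).
Variables (p : nat) (p_pr : prime p).
Local Notation O := (integral_closure h).

Lemma exprD_prime_integral x y : x \in O -> y \in O ->
  exists2 w, w \in O & (x + y) ^+ p = x ^+ p + y ^+ p + p%:R * w.
Proof.
move=> xO yO; have p_gt0 := prime_gt0 p_pr.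
exists (\sum_(1 <= i < p) (x ^+ (p - i) * y ^+ i) *+ ('C(p, i) %/ p)).
  by rewrite rpred_sum // => i _; rewrite rpredMn ?rpredM ?rpredX.
rewrite exprDn -(big_mkord xpredT (fun i => x ^+ (p - i) * y ^+ i *+ 'C(p, i))).
rewrite big_nat_recr //= big_ltn // bin0 subn0 subnn binn mulr1 mul1r !mulr1n.
rewrite addrAC mulr_sumr; congr (_ + _); apply: eq_big_nat => i /andP[i_gt0 ip].
by rewrite mulr_natl -mulrnA divnK // prime_dvd_bin // i_gt0.
Qed.

Lemma exprD_primeX_integral k x y : x \in O -> y \in O ->
  exists2 w, w \in O &
    (x + y) ^+ (p ^ k) = x ^+ (p ^ k) + y ^+ (p ^ k) + p%:R * w.
Proof.
move=> xO yO; elim: k => [|k [w wO wE]].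
  by exists 0; rewrite ?rpred0 // mulr0 addr0 expn0 !expr1.
have [||w1 w1O w1E] := @exprD_prime_integral (x ^+ (p ^ k)) (y ^+ (p ^ k)).
- exact: rpredX.
- exact: rpredX.
have [||w2 w2O w2E] :=
  @exprD_prime_integral (x ^+ (p ^ k) + y ^+ (p ^ k)) (p%:R * w).
- by rewrite rpredD ?rpredX.
- by rewrite rpredM ?rpred_nat.
exists (w1 + p%:R ^+ p.-1 * w ^+ p + w2).
  by rewrite !rpredD ?rpredM ?rpredX ?rpred_nat.
rewrite !expnSr !exprM wE w2E w1E -!addrA; congr (_ + (_ + _)).
rewrite !mulrDr mulrA -exprS prednK ?prime_gt0 // exprMn.
by [].
Qed.

Lemma exprB_primeX_integral k x y : x \in O -> y \in O ->
  exists2 w, w \in O &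
    (x - y) ^+ (p ^ k) = x ^+ (p ^ k) - y ^+ (p ^ k) + p%:R * w.
Proof.
(* Expanding [x] as (x - y) + y avoids the sign (-1)^(p^k), which is not -1 when p = 2 and k > 0. *)
move=> xO yO; have [||w wO] := @exprD_primeX_integral k (x - y) y => //.
  exact: rpredB.
rewrite subrK => ->; exists (- w); first by rewrite rpredN.
by rewrite mulrN addrAC addrK addrK.
Qed.
End Frobenius.

(** * O_K as a valuation ring, and its residues *)

Section ValuationRing.
Variables (p : nat) (p_pr : prime p) (K : fieldExtType (padic p_pr)).
Local Notation Zp := (padic_int p_pr).
Local Notation Zp_in := (@padic_int_in p p_pr K).
Local Notation O := (integral_closure Zp_in).

Lemma OKE x : OK K x <-> x \in O.
Proof. by split=> [[_ /asboolP]|/asboolP]. Qed.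

(** Inverses are taken in the field K. Zero is set apart because its inverse is 0 by convention,
    which is integral. *)
Lemma mKE x : mK K x <-> x \in O /\ (x = 0 \/ x^-1 \notin O).
Proof.
split=> [[/OKE xO xN]|[xO xN]].
  split=> //; have [->|x0] := eqVneq x 0; [by left | right].
  apply/negP => xVO; apply: xN; exists x^-1; first exact/OKE.
  by rewrite divff.
split; [exact/OKE | case=> y /OKE yO xy1].
have x0 : x != 0.
  by apply: contra_eq_neq xy1 => ->; rewrite mul0r eq_sym oner_eq0.
case: xN => [/eqP|/negP[]]; first exact/negP.
by rewrite -[x^-1]mulr1 -xy1 mulKf.
Qed.

Lemma mK_integral x : mK K x -> x \in O.
Proof. by move=> /mKE[]. Qed.

Lemma notin_mK x : x \in O -> ~ mK K x -> x != 0 /\ x^-1 \in O.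
Proof.
move=> xO xN; split.
  by apply/eqP => x0; apply: xN; apply/mKE; split=> //; left.
by apply/negP => /negP xV; apply: xN; apply/mKE; split=> //; right.
Qed.

Lemma mK0 : mK K 0.
Proof. by apply/mKE; rewrite rpred0; split=> //; left. Qed.

Lemma mK_not1 : ~ mK K 1.
Proof.
by move=> /mKE[_ []]; [apply/eqP; exact: oner_neq0 | rewrite invr1 rpred1].
Qed.

Lemma mKM x y : mK K x -> y \in O -> mK K (x * y).
Proof.
move=> /mKE[xO xN] yO; apply/mKE; split; first exact: rpredM.
have [->|x0] := eqVneq x 0; first by left; rewrite mul0r.
have [->|y0] := eqVneq y 0; first by left; rewrite mulr0.
right; case: xN => [/eqP|]; first by rewrite (negPf x0).
apply: contra => xyV; have -> : x^-1 = (x * y)^-1 * y by rewrite invfM mulfVK.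
by rewrite rpredM.
Qed.

Lemma natp_in_K_neq0 : p%:R != 0 :> K.
Proof. exact: natp_image_neq0 (@padic_int_in_inj _ _ K). Qed.

Lemma mK_natp : mK K p%:R.
Proof.
apply/mKE; rewrite rpred_nat; split=> //; right.
exact: natp_inv_nonintegral (@padic_int_in_inj _ _ K).
Qed.

Hypothesis mK_add : forall x y, mK K x -> mK K y -> mK K (x + y).

Lemma mK_sum (I : Type) (r : seq I) (P : pred I) (a : I -> K) :
  (forall i, P i -> mK K (a i)) -> mK K (\sum_(i <- r | P i) a i).
Proof. by move=> aM; elim/big_ind: _ => //; apply: mK0. Qed.

(** With v u = 1 + p w, having [u] in m_K would put 1 = u v - p w in m_K. *)
Lemma residue_unit (u : Zp) :
  u 0 != 0 -> Zp_in u != 0 /\ (Zp_in u)^-1 \in O.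
Proof.
move=> /residue_mul1_modp[v [w vuE]].
have uO := integral_closure_id Zp_in u.
apply: notin_mK => // uM; apply: mK_not1.
have -> : 1 = Zp_in u * Zp_in v + p%:R * Zp_in (- w) :> K.
  rewrite mulrC -rmorphM vuE rmorphD rmorph1 rmorphM rmorph_nat rmorphN mulrN.
  by rewrite addrK.
by apply: mK_add; apply: mKM; rewrite ?integral_closure_id //; apply: mK_natp.
Qed.

(* The Horner partial values B_i of an annihilating polynomial of z and the
   products B_(i+1) z are integral. A unit coefficient is a difference
   B_j - B_(j+1) z, so by locality one of the two terms is a unit. *)
Lemma valuation_ring (z : K) : z \in O \/ z^-1 \in O.
Proof.
have [P [_ Pz [j Pj]]] := primitive_annihilator z.
set q := map_poly Zp_in P in Pz; pose B i := (drop_poly i q).[z].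
have qO i : q`_i \in O by rewrite coef_map integral_closure_id.
have BE i : B i = B i.+1 * z + q`_i.
  rewrite /B; have -> : drop_poly i q = drop_poly i.+1 q * 'X + (q`_i)%:P.
    apply/polyP => k; rewrite coefD coefMX coefC !coef_drop_poly.
    by case: k => [|k] /=; rewrite ?add0r ?addr0 // addSnnS.
  by rewrite hornerMXaddC.
have BO m i : (size q <= i + m)%N -> B i \in O.
  elim: m i => [|m IHm] i sq.
    by rewrite /B drop_poly_eq0 ?horner0 ?rpred0 // -[i]addn0.
  have bO : B i.+1 \in O by apply: IHm; rewrite addSnnS.
  rewrite BE rpredD //; set b := B i.+1 in bO *.
  apply: (@integral_closure_dominant _ _ _ i _ _ (take_poly i.+1 q)) => //.
  - by move=> k; rewrite coef_take_poly; case: ifP => _; rewrite ?rpred0.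
  - exact: size_take_poly.
  move/eqP: (Pz); rewrite -{1}(poly_take_drop i.+1 q) hornerD hornerM hornerXn.
  by rewrite addrC.
have {}BO i : B i \in O by apply: (BO (size q)); rewrite leq_addl.
have BzO i : B i.+1 * z \in O.
  by rewrite -[_ * z](addrK q`_i) -BE rpredB.
have [qj0 qjV] := residue_unit Pj.
have [BM|/notin_mK[//|B0 BV]] := pselect (mK K (B j)).
  right; have [BzM|/notin_mK[//|Bz0 BzV]] := pselect (mK K (B j.+1 * z)).
    case/mKE: (mK_add BM (mKM BzM (rpredN1 _))) => _.
    rewrite BE mulrN1 addrAC addrN add0r /q coef_map.
    by case=> [/eqP|]; rewrite ?(negPf qj0) ?qjV.
  move: Bz0; rewrite mulf_eq0 negb_or => /andP[b0 z0].
  have -> : z^-1 = B j.+1 * (B j.+1 * z)^-1 by rewrite invfM mulVKf.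
  by rewrite rpredM ?BO.
left; case: j BV B0 {Pj qj0 qjV} => [|j] BV B0.
  by move: B0; rewrite /B drop_poly0l (eqP Pz) eqxx.
by rewrite -[z](mulKf B0) rpredM ?BzO.
Qed.

Lemma mK_inv z : z \notin O -> mK K z^-1.
Proof.
move=> zO; apply/mKE; rewrite invrK; split; last by right.
by case: (valuation_ring z) => // zI; rewrite zI in zO.
Qed.

(* Otherwise p / c^e is in m_K, and in a primitive relation of degree at most
   e = [K : Q_p] between the powers of c the first term with a unit coefficient
   strictly dominates all the others. *)
Lemma natp_dvd_mK_exp c : mK K c -> c ^+ \dim {:K} / p%:R \in O.
Proof.
move=> cM; set e := \dim {:K}.
have e_gt0 : (0 < e)%N by apply: (adim_gt0 {:K}%AS).
have [->|c0] := eqVneq c 0; first by rewrite expr0n gtn_eqF // mul0r rpred0.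
apply: contrapT => /negP /mK_inv; rewrite invfM invrK => dM.
have [P [sP Pc [i Pi]]] := primitive_annihilator c.
have exP : exists i, P`_i 0 != 0 by exists i.
case: (ex_minnP exP) => m Pm m_min.
have sm : (m < size P)%N.
  by rewrite ltnNge; apply: contra Pm => /(nth_default 0) ->.
have me : (m <= e)%N by rewrite -ltnS (leq_trans sm).
have [u0 uV] := residue_unit Pm.
suff /mKE[_ []] : mK K (Zp_in P`_m).
- exact/eqP.
- by rewrite uV.
have cm0 : c ^+ m != 0 by rewrite expf_neq0.
move/eqP: Pc; rewrite horner_coef size_map_inj_poly ?rmorph0 //; last first.
  exact: padic_int_in_inj.
rewrite (bigD1 (Ordinal sm)) //= coef_map /= => /eqP.
rewrite addr_eq0 => /eqP uE.
rewrite -[Zp_in _](mulfK cm0) uE mulNr -mulrN1 mulr_suml.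
apply: mKM; last exact: rpredN1.
apply: mK_sum => k; rewrite -val_eqE neq_ltn /= coef_map /= => /orP[km|mk].
  have [y ->] : exists y, P`_k = p%:R * y.
    by apply/residue0_dvdp/eqP/negPn/negP => /m_min; rewrite leqNgt km.
  rewrite rmorphM rmorph_nat.
  have -> : p%:R * Zp_in y * c ^+ k / c ^+ m =
            ((c ^+ e)^-1 * p%:R) * (Zp_in y * c ^+ (e - m + k)).
    have ce0 : c ^+ e != 0 by rewrite expf_neq0.
    have kmE : c ^+ k / c ^+ m = (c ^+ e)^-1 * c ^+ (e - m + k).
      apply: (mulfI ce0); apply: (mulIf cm0).
      by rewrite mulVKf // -mulrA mulfVK // -!exprD addnAC subnK.
    by rewrite -mulrA kmE mulrACA [p%:R * _]mulrC.
  apply: mKM => //; rewrite rpredM ?integral_closure_id //.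
  by rewrite rpredX // mK_integral.
rewrite -mulrA -expfB // -(prednK (n := (k - m)%N)) ?subn_gt0 // exprS mulrCA.
apply: mKM => //; rewrite rpredM ?integral_closure_id //.
by rewrite rpredX // mK_integral.
Qed.

(** Divisibility is total in a valuation ring, so an element of least valuation divides the others;
    adding p to the list keeps it nonzero. It stands in for a uniformizer. *)
Lemma mK_common_divisor (s : seq K) : (forall x, x \in s -> mK K x) ->
  exists c, [/\ c != 0, mK K c & forall x, x \in s -> x / c \in O].
Proof.
elim: s => [|x s IHs] sM.
  exists p%:R; split=> //; [exact: natp_in_K_neq0 | exact: mK_natp].
have [y ys|c [c0 cM cdvd]] := IHs; first by apply: sM; rewrite inE ys orbT.
have [xcO|xcN] := boolP (x / c \in O).
  by exists c; split=> // y; rewrite inE => /predU1P[->|/cdvd].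
have x0 : x != 0 by apply: contraNneq xcN => ->; rewrite mul0r rpred0.
exists x; split=> //; first by apply: sM; rewrite mem_head.
move=> y; rewrite inE => /predU1P[->|/cdvd ycO]; first by rewrite divff ?rpred1.
have -> : y / x = (y / c) * (c / x) by rewrite mulrA mulfVK.
rewrite rpredM //.
by have /mK_integral := mK_inv xcN; rewrite invf_div.
Qed.

Lemma mK_exp x m : x \in O -> mK K (x ^+ m) -> mK K x.
Proof.
move=> xO /mKE[_ xmN]; apply: contrapT => /(notin_mK xO)[x0 xV].
case: xmN => [/eqP|/negP[]]; first exact/negP/expf_neq0.
by rewrite -exprVn rpredX.
Qed.

(** Pigeonhole: modulo a monic equation [P] of [y], the power y^(q^i) is a polynomial in [y] of
    degree below that of [P], and its coefficients modulo p, the [code] of i, take finitely many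
    values. *)
Lemma frobenius_period y a : y \in O ->
  exists2 r, (0 < r)%N & mK K (y ^+ ((p ^ a) ^ r) - y).
Proof.
move=> yO; have [P Pm Py] := asboolP _ yO; set q := (p ^ a)%N.
pose r (i : nat) : {poly Zp} := Pdiv.Ring.rmodp 'X^(q ^ i) P.
have rE i : y ^+ (q ^ i) = (map_poly Zp_in (r i)).[y].
  rewrite -hornerXn -(map_polyXn Zp_in) (Pdiv.RingMonic.rdivp_eq Pm 'X^(q ^ i)).
  by rewrite rmorphD rmorphM hornerD hornerM (eqP Py) mulr0 add0r.
pose code (i : nat) := [ffun k : 'I_(size P) => (r i)`_k 0].
have code_eq i j : code i = code j -> mK K (y ^+ (q ^ i) - y ^+ (q ^ j)).
  move=> ijE; rewrite !rE -hornerN -hornerD -rmorphB horner_coef.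
  apply: mK_sum => k _; rewrite coef_map /=; apply: mKM; last exact: rpredX.
  have [y1 ->] : exists y1, (r i - r j)`_k = p%:R * y1.
    apply: residue0_dvdp; rewrite coefB residueD residueN.
    have [kP|kP] := ltnP k (size P).
      have /ffunP/(_ (Ordinal kP)) := ijE.
      by rewrite !ffunE /= => ->; rewrite subrr.
    have sr l : (size (r l) <= k)%N.
      by rewrite (leq_trans _ kP) // ltnW // Pdiv.Ring.ltn_rmodp // monic_neq0.
    by rewrite !nth_default // subrr.
  rewrite rmorphM rmorph_nat; apply: mKM (integral_closure_id _ _).
  exact: mK_natp.
have [i [j [ij ijE]]] : exists i j : nat, (i < j)%N /\ code i = code j.
  apply: contrapT => codeN.
  pose T := {ffun 'I_(size P) -> 'Z_(p ^ 1)}.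
  pose c (k : 'I_#|T|.+1) : T := code k.
  have c_inj : injective c.
    move=> k l ckl; apply: val_inj; apply: contrapT => /eqP.
    rewrite neq_ltn => /orP[kl|lk]; apply: codeN; first by exists k, l.
    by exists l, k.
  by have := leq_card _ c_inj; rewrite card_ord ltnn.
exists (j - i)%N; first by rewrite subn_gt0.
(* From y^(q^j) = y^(q^i) modulo m_K, the exponent q^i is cancelled since the Frobenius is injective
   modulo m_K. *)
set z := y ^+ _; apply: (@mK_exp _ (p ^ (a * i))).
  by rewrite rpredB ?rpredX.
have [||w wO ->] := @exprB_primeX_integral _ _ Zp_in _ p_pr (a * i) z y => //.
  exact: rpredX.
apply: mK_add; last by apply: mKM => //; apply: mK_natp.
rewrite -exprM expnM -/q -expnD subnK; last exact: ltnW.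
exact: code_eq.
Qed.

End ValuationRing.

(** * Integers of the algebraic closure, approximation by K, and the ideal generated by m_K *)

Section AlgebraicClosure.
Variables (p : nat) (p_pr : prime p) (K : fieldExtType (padic p_pr)).
Variables (Kbar : closedFieldType) (iota : {rmorphism K -> Kbar}).
Local Notation Zp := (padic_int p_pr).
Local Notation Zp_in := (@padic_int_in p p_pr K).
Local Notation O := (integral_closure Zp_in).
Local Notation Obar := (integral_closure (iota \o Zp_in)).

Lemma iota_integral x : (iota x \in Obar) = (x \in O).
Proof.
apply/asboolP/asboolP => [[P Pm]|]; last exact: integral_rmorph.
by rewrite map_poly_comp fmorph_root; exists P.
Qed.

Lemma natp_inv_notin_Obar : p%:R^-1 \notin Obar.
Proof.
by rewrite -(rmorph_nat iota) -fmorphV iota_integral natp_inv_nonintegral //;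
  exact: padic_int_in_inj.
Qed.

Lemma common_denominator (s : seq K) :
  exists2 a : Zp, a != 0 & forall x, x \in s -> Zp_in a * x \in O.
Proof.
elim: s => [|x s [a a0 as_O]]; first by exists 1; rewrite ?oner_neq0.
have [P [_ Px [i Pi]]] := primitive_annihilator x.
have P0 : P != 0 by apply: contraNneq Pi => ->; rewrite coef0.
exists (a * lead_coef P); first by rewrite mulf_neq0 // lead_coef_eq0.
have PxO : Zp_in (lead_coef P) * x \in O.
  rewrite -lead_coef_map_inj ?rmorph0 //; last exact: padic_int_in_inj.
  apply: integral_closure_lead_coef => // k.
  by rewrite coef_map integral_closure_id.
move=> y; rewrite inE rmorphM => /predU1P[->|/as_O ayO].
  by rewrite -mulrA rpredM // integral_closure_id.
by rewrite mulrAC rpredM // integral_closure_id.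
Qed.

Hypothesis Kbar_closure : is_algebraic_closure iota.

Lemma integral_multiple (x : Kbar) :
  exists2 a : Zp, a != 0 & iota (Zp_in a) * x \in Obar.
Proof.
have [P Pm Px] := (integral_algebraic iota x).1 (Kbar_closure x).
have [a a0 aP] := common_denominator P; exists a => //.
have aPx : root (map_poly iota (Zp_in a *: P)) x.
  by rewrite map_polyZ rootE hornerZ (eqP Px) mulr0.
have := @integral_closure_lead_coef _ _ _ _ _ _ aPx.
rewrite lead_coef_map lead_coefZ (monicP Pm) mulr1; apply=> i.
rewrite coef_map coefZ iota_integral; have [iP|iP] := ltnP i (size P).
  exact/aP/mem_nth.
by rewrite nth_default // mulr0 rpred0.
Qed.

(** If x is nonzero, some a/x is integral with a = p^k u and u nonzero modulo p. Multiplying by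
    x/p^(k+1) makes u/p integral, and with v u = 1 + p w so is 1/p = v u/p - w, a contradiction. *)
Lemma natp_divisible_eq0 (x : Kbar) :
  (forall j, x / p%:R ^+ j \in Obar) -> x = 0.
Proof.
move=> xdiv; apply/eqP; apply: contrapT => /negP x0.
have [a a0 axO] := integral_multiple x^-1.
have [k [u [aE u0]]] := residue_factor a0.
have [v [w vuE]] := residue_mul1_modp u0.
have p0 : p%:R != 0 :> Kbar.
  by rewrite -(rmorph_nat iota) fmorph_eq0 natp_in_K_neq0.
case/negP: natp_inv_notin_Obar.
have := rpredM axO (xdiv k.+1).
rewrite aE !rmorphM !rmorphXn !rmorph_nat /=.
have pk0 : (p%:R : Kbar) ^+ k != 0 by rewrite expf_neq0.
rewrite mulrA divfK // exprSr invfM mulrACA divff // mul1r => uO.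
have -> : p%:R^-1 = iota (Zp_in v) * (iota (Zp_in u) / p%:R) - iota (Zp_in w).
  rewrite mulrA -!rmorphM vuE rmorphD rmorph1 rmorphM rmorph_nat /=.
  rewrite rmorphD rmorph1 rmorphM rmorph_nat /= mulrDl mul1r.
  by rewrite mulrAC divff // mul1r addrK.
have vO : iota (Zp_in v) \in Obar by rewrite iota_integral integral_closure_id.
by rewrite rpredB ?iota_integral ?integral_closure_id // (rpredM vO uO).
Qed.

(* The hypothesis says that [t] lies in the closure of [K]; its conjugates then
   have the same approximations, so they all equal [t], and the trace of [t]
   is a nonzero integer multiple of [t]. *)
Lemma approximable_in_K (t : Kbar) :
  (forall j, exists y : K, (t - iota y) / p%:R ^+ j \in Obar) ->
  exists x : K, t = iota x.
Proof.
move=> t_approx.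
have iota_dec : decidable_embedding iota by move=> y; apply: pselect.
have t_alg := (integral_algebraic iota t).1 (Kbar_closure t).
have [g [gm gt g_irr]] := minPoly_decidable_closure iota_dec t_alg.
have conj_eq s : root (map_poly iota g) s -> s = t.
  move=> gs; apply/eqP; rewrite eq_sym -subr_eq0; apply/eqP.
  apply: natp_divisible_eq0 => j; have [y yO] := t_approx j.
  have -> : (t - s) / p%:R ^+ j =
      (t - iota y) / p%:R ^+ j - (s - iota y) / p%:R ^+ j.
    by rewrite -mulrBl opprB addrA subrK.
  rewrite rpredB //; case/asboolP: yO => P Pm Pt; apply/asboolP; exists P => //.
  (* [S] has coefficients in K and vanishes at z exactly when [P] vanishes at (z - y)/p^j. As S(t) =
     0, the minimal polynomial [g] of [t] divides [S], so S(s) = 0. *)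
  pose S := map_poly Zp_in P \Po ((p%:R ^- j)%:P * ('X - y%:P)).
  have SE z : (map_poly iota S).[z] =
      (map_poly (iota \o Zp_in) P).[(z - iota y) / p%:R ^+ j].
    rewrite map_comp_poly horner_comp -map_poly_comp rmorphM rmorphB /=.
    rewrite !map_polyC map_polyX /= hornerM hornerD hornerN !hornerC hornerX.
    by rewrite fmorphV rmorphXn rmorph_nat mulrC.
  rewrite rootE -SE -rootE.
  have g_dvd_S : g %| S.
    have : root (map_poly iota (gcdp g S)) t.
      by rewrite gcdp_map root_gcd gt rootE SE -rootE.
    have [/eqP/size_poly1P[c c0 ->]|sgS _] := eqVneq (size (gcdp g S)) 1.
      by rewrite map_polyC rootC fmorph_eq0 (negPf c0).
    have /eqp_dvdl <- := g_irr.2 _ sgS (dvdp_gcdl g S).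
    exact: dvdp_gcdr.
  by move: gs; rewrite -!dvdp_XsubCl => /dvdp_trans -> //; rewrite dvdp_map.
have [r rE] := closed_field_poly_normal (map_poly iota g).
move: rE; rewrite (monicP _) ?monic_map // scale1r => rE.
have rt : all (pred1 t) r.
  by apply/allP => s sr; apply/eqP/conj_eq; rewrite rE root_prod_XsubC.
have r0 : size r != 0.
  by apply: contraL gt; rewrite rE root_prod_XsubC size_eq0 => /eqP ->.
exists (- g`_(size r).-1 / (size r)%:R).
have := coefPn_prod_XsubC r0; rewrite -rE coef_map /= => gE.
rewrite fmorph_div rmorphN rmorph_nat gE opprK (all_pred1P _ _ rt).
rewrite big_nseq size_nseq iter_addr_0 -[t *+ _]mulr_natr mulfK //.
rewrite -(rmorph_nat (iota \o Zp_in)) -(rmorph0 (iota \o Zp_in)).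
rewrite (inj_eq (inj_comp (fmorph_inj iota) (@padic_int_in_inj _ _ K))).
exact: natr_padic_neq0.
Qed.

Lemma adjoin_id (t : Kbar) : adjoin iota t t.
Proof. by move=> S _ _. Qed.

Lemma adjoin_iota (t : Kbar) x : adjoin iota t (iota x).
Proof. by move=> S _ SK _; apply: SK. Qed.

Lemma adjoinB (t x y : Kbar) :
  adjoin iota t x -> adjoin iota t y -> adjoin iota t (x - y).
Proof.
move=> Kx Ky S SD SK St; have [_ SB _] := SD.
by apply: SB; [apply: Kx | apply: Ky].
Qed.

Lemma adjoin_in_K (x : K) y : adjoin iota (iota x) y -> exists z, y = iota z.
Proof.
move=> /(_ (fun y => `[< exists z, y = iota z >])) Ky; apply/asboolP/Ky.
- split=> [|_ _ /asboolP[u ->] /asboolP[v ->]|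
            _ _ /asboolP[u ->] /asboolP[v ->]].
  + by apply/asboolP; exists 1; rewrite rmorph1.
  + by apply/asboolP; exists (u - v); rewrite rmorphB.
  + by apply/asboolP; exists (u / v); rewrite fmorph_div.
- by move=> z; apply/asboolP; exists z.
- by apply/asboolP; exists x.
Qed.

(* The ideal generated by [mK] in the integers of [K(t)] contains the image of
   [mK + mK], so if it consists of nonunits, then [mK + mK] does, too: the
   locality of [OK] needs no separate proof. *)
Lemma mK_add_unramified (t : Kbar) x y : unramified iota (adjoin iota t) ->
  mK K x -> mK K y -> mK K (x + y).
Proof.
move=> t_unr xM yM; have xyO : x + y \in O by rewrite rpredD ?mK_integral.
have: mL iota (adjoin iota t) (iota (x + y)).
  rewrite t_unr; exists 2, (fun i => iota (if i == 0 then x else y)), (fun=> 1).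
  split=> [i|i|].
  - by case: (i == 0); [exists x | exists y].
  - by split; [move=> S [] | exact: integral1].
  - by rewrite big_ord_recl big_ord1 !mulr1 rmorphD.
case=> _ xy_nonunit; split; first exact/OKE.
case=> z /OKE zO xyz; apply: xy_nonunit; exists (iota z).
  split; first exact: adjoin_iota.
  by apply/integral_closureP; rewrite iota_integral.
by rewrite -rmorphM xyz rmorph1.
Qed.

Hypothesis mK_add : forall x y, mK K x -> mK K y -> mK K (x + y).

(** This is the ideal of [Obar] generated by m_K. One divisor [c] replaces finite sums, since O_K is
    a valuation ring, and provides the modulus for the contraction. *)
Definition mKbar : {pred Kbar} :=
  fun x => `[< exists c, [/\ c != 0, mK K c & x / iota c \in Obar] >].

Lemma mKbar_add x y : x \in mKbar -> y \in mKbar -> x + y \in mKbar.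
Proof.
move=> /asboolP[c [c0 cM xc]] /asboolP[d [d0 dM yd]].
have [z|b [b0 bM bdvd]] := mK_common_divisor mK_add (s := [:: c; d]).
  by rewrite !inE => /orP[] /eqP ->.
apply/asboolP; exists b; split=> //.
have lift u e : e != 0 -> u / iota e \in Obar -> e / b \in O ->
    u / iota b \in Obar.
  move=> e0 ue eb; have -> : u / iota b = (u / iota e) * iota (e / b).
    by rewrite fmorph_div mulrA divfK ?fmorph_eq0.
  by rewrite rpredM // iota_integral.
by rewrite mulrDl rpredD // ?(lift x c) ?(lift y d) // bdvd // !inE eqxx ?orbT.
Qed.

Lemma mKbar_mul x y : x \in mKbar -> y \in Obar -> x * y \in mKbar.
Proof.
move=> /asboolP[c [c0 cM xc]] yO; apply/asboolP; exists c; split=> //.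
by rewrite mulrAC rpredM.
Qed.

Lemma mKbar_iota c : mK K c -> iota c \in mKbar.
Proof.
move=> cM; have [z|d [d0 dM cd]] := mK_common_divisor mK_add (s := [:: c]).
  by rewrite inE => /eqP ->.
apply/asboolP; exists d; split=> //.
by rewrite -fmorph_div iota_integral cd ?mem_head.
Qed.

Lemma mKbar_sum (I : Type) (r : seq I) (P : pred I) (u : I -> Kbar) :
  (forall i, P i -> u i \in mKbar) -> \sum_(i <- r | P i) u i \in mKbar.
Proof.
move=> uM; elim/big_ind: _ => //; last exact: mKbar_add.
by rewrite -(rmorph0 iota) mKbar_iota //; apply: mK0.
Qed.

Lemma mKbar_natp : p%:R \in mKbar.
Proof. by rewrite -(rmorph_nat iota) mKbar_iota //; apply: mK_natp. Qed.

Lemma mKbar_not1 : 1 \notin mKbar.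
Proof.
apply/negP => /asboolP[c [c0 /mKE[_ [/eqP|]]]]; first by rewrite (negPf c0).
by rewrite mul1r -fmorphV iota_integral => /negPf ->.
Qed.

Lemma mKbar_expB x y m : x \in Obar -> y \in Obar -> x - y \in mKbar ->
  x ^+ m - y ^+ m \in mKbar.
Proof.
move=> xO yO xyM; rewrite subrXX; apply: mKbar_mul => //.
by rewrite rpred_sum // => i _; rewrite rpredM ?rpredX.
Qed.

(** The q-power map, q = p^a, brings [y] back to itself modulo m_K after r > 0 steps, so its value
    after r - 1 steps is a q-th root. *)
Lemma mK_root a y : y \in O -> (exists2 x, x \in O & mK K (x ^+ (p ^ a) - y)).
Proof.
move=> yO; have [r r_gt0 yr] := frobenius_period mK_add a yO.
exists (y ^+ ((p ^ a) ^ r.-1)); first exact: rpredX.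
by rewrite -exprM -expnSr prednK.
Qed.

(** A nonunit of [Obar] lying in K(t) is a nonunit among the integers of K(t), whose maximal ideal
    is generated by m_K. *)
Lemma nonunit_unramified (t s : Kbar) : unramified iota (adjoin iota t) ->
  adjoin iota t s -> s \in Obar ->
  (forall y, y \in Obar -> s * y != 1) -> s \in mKbar.
Proof.
move=> t_unr ts sO s_nonunit.
have: mL iota (adjoin iota t) s.
  split; first by split=> //; apply/asboolP.
  by case=> y [_ /asboolP yO] sy; case/eqP: (s_nonunit y yO).
rewrite t_unr => -[m [u [v [uM vO ->]]]]; apply: mKbar_sum => i _.
have [c cM <-] := uM i; apply: mKbar_mul; first exact: mKbar_iota.
by apply/asboolP; have [] := vO i.
Qed.

(** * Iteration of f and descent of approximations along the sequence t_n *)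

Section Dynamics.
Variables (f : {poly K}) (a : nat).
Hypotheses (f_integral : forall i, f`_i \in O) (a_gt0 : (0 < a)%N).
Hypothesis f_mod : forall i, mK K (f - 'X^(p ^ a))`_i.
Local Notation q := (p ^ a)%N.
Local Notation fbar := (map_poly iota f).

Lemma fbar_integral i : fbar`_i \in Obar.
Proof. by rewrite coef_map iota_integral. Qed.

Lemma fbar_monic_mod x : x \in Obar -> x ^+ q - fbar.[x] \in mKbar.
Proof.
move=> xO; rewrite -opprB -mulrN1; apply: mKbar_mul; last exact: rpredN1.
have -> : fbar.[x] - x ^+ q = (map_poly iota (f - 'X^q)).[x].
  by rewrite rmorphB /= hornerD hornerN map_polyXn hornerXn.
rewrite horner_coef; apply: mKbar_sum => i _; rewrite coef_map.
by apply: mKbar_mul; [apply: mKbar_iota | apply: rpredX].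
Qed.

(** With d = x - y, f(x) - f(y) = f'(y) d + v d^2. The first term gains a factor c because c divides
    f'(y), the second because 2(k+1) is at least k+2. *)
Lemma fbar_contraction c k x y : c != 0 -> mK K c ->
  p%:R / c \in O -> (forall i, (f - 'X^q)`_i / c \in O) ->
  y \in Obar -> (x - y) / iota c ^+ k.+1 \in Obar ->
  (fbar.[x] - fbar.[y]) / iota c ^+ k.+2 \in Obar.
Proof.
move=> c0 cM pc fc yO; set C := iota c; set w := (x - y) / _ => wO.
have C0 : C != 0 by rewrite fmorph_eq0.
have CO : C \in Obar by rewrite iota_integral mK_integral.
have xE : x = y + w * C ^+ k.+1 by rewrite divfK ?expf_neq0 // addrC subrK.
clearbody w.
have dO : w * C ^+ k.+1 \in Obar by rewrite rpredM // rpredX.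
have [v vO vE] := integral_closure_taylor fbar_integral yO dO.
have dfO : fbar^`().[y] / C \in Obar.
  rewrite mulrC -hornerZ integral_closure_horner // => i.
  rewrite deriv_map coefZ coef_map -fmorphV -rmorphM iota_integral coef_deriv.
  (* f' is the sum of q X^(q-1), divisible by c as p divides q, and of the derivative of f - X^q. *)
  have -> : c^-1 * (f`_i.+1 *+ i.+1) =
      (i.+1 == q)%:R * (q%:R / c) + (f - 'X^q)`_i.+1 / c *+ i.+1.
    rewrite coefB coefXn -(mulr_natr f`_i.+1) -(mulr_natr (_ / c)).
    by case: eqP => [<-|_] /=;
      move: (i.+1%:R : K) (f`_i.+1) (c^-1) => m u b; ring.
  rewrite rpredD //; last by rewrite rpredMn ?fc.
  rewrite -[in X in _ * (X / _)](prednK a_gt0) expnS natrM mulrAC.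
  by rewrite rpredM ?rpred_nat // rpredM ?rpred_nat.
rewrite xE vE.
have -> : (fbar.[y] + fbar^`().[y] * (w * C ^+ k.+1) + v * (w * C ^+ k.+1) ^+ 2
    - fbar.[y]) / C ^+ k.+2 = fbar^`().[y] / C * w + v * w ^+ 2 * C ^+ k.
  rewrite !exprS; have : C ^+ k != 0 by rewrite expf_neq0.
  by move: (C ^+ k) => Ck Ck0; field; rewrite C0 Ck0.
have vwO : v * w ^+ 2 \in Obar by rewrite rpredM ?rpredX.
by rewrite (rpredD (rpredM dfO wO)) ?(rpredM vwO) ?rpredX.
Qed.

Variable t : nat -> Kbar.
Hypotheses (f_monic : f \is monic) (f_size : (1 < size f)%N).
Hypotheses (t_step : forall n, fbar.[t n.+1] = t n).
Variable t0 : K.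
Hypotheses (t0_integral : t0 \in O) (t0E : t 0 = iota t0).
Hypothesis t_unramified : forall n, unramified iota (adjoin iota (t n)).

Lemma t_integral n : t n \in Obar.
Proof.
elim: n => [|n IHn]; first by rewrite t0E iota_integral.
apply: (@integral_closure_root _ _ _ (fbar - (t n)%:P)).
- rewrite monicE lead_coefDl ?lead_coef_map ?(monicP f_monic) ?rmorph1 //.
  by rewrite size_polyN size_map_poly (leq_ltn_trans (size_polyC_leq1 _)) //.
- by rewrite rootE hornerD hornerN hornerC t_step subrr.
- move=> i; rewrite coefB coefC rpredB ?fbar_integral //.
  by case: eqP; rewrite ?rpred0.
Qed.

(** Modulo m_K, t_(n+1)^q is f(t_(n+1)) = t_n; raise this to the power q^n. *)
Lemma t_expn_mod n : t n ^+ (q ^ n) - iota t0 \in mKbar.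
Proof.
elim: n => [|n IHn].
  by rewrite expr1 t0E subrr -(rmorph0 iota) mKbar_iota //; apply: mK0.
rewrite -[t n.+1 ^+ _](subrK (t n ^+ (q ^ n))) -addrA mKbar_add //.
rewrite expnS exprM mKbar_expB ?rpredX ?t_integral //.
by rewrite -[X in _ - X]t_step fbar_monic_mod ?t_integral.
Qed.

Lemma mK_root_iter n : exists2 x, x \in O & mK K (x ^+ (q ^ n) - t0).
Proof.
by have := mK_root (a * n) t0_integral; rewrite expnM.
Qed.

(** Let x be a q^n-th root of t_0 modulo m_K. By Frobenius, (t_n - x)^(q^n) lies in [mKbar], so an
    integral inverse of t_n - x would put 1 there; hence [nonunit_unramified] applies. *)
Lemma t_residue n : exists2 x, x \in O & t n - iota x \in mKbar.
Proof.
have [x xO xM] := mK_root_iter n; exists x => //.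
have ixO : iota x \in Obar by rewrite iota_integral.
have sO : t n - iota x \in Obar by rewrite rpredB ?t_integral.
apply: nonunit_unramified (t_unramified n) _ sO _.
  by apply: adjoinB; [apply: adjoin_id | apply: adjoin_iota].
move=> y yO; apply/eqP => sy.
have [w wO] := exprB_primeX_integral p_pr (a * n) (t_integral n) ixO.
rewrite expnM => sE; case/negP: mKbar_not1.
rewrite -(expr1n _ (q ^ n)) -sy exprMn; apply: mKbar_mul; last exact: rpredX.
rewrite sE; apply: mKbar_add; last by apply: mKbar_mul => //; apply: mKbar_natp.
rewrite -[t n ^+ _](subrK (iota t0)) -addrA mKbar_add ?t_expn_mod //.
rewrite -opprB -mulrN1; apply: mKbar_mul; last exact: rpredN1.
by rewrite -rmorphXn -rmorphB mKbar_iota.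
Qed.

(** Each of the m steps down applies f to both t and its approximation, which stays in K, and gains
    one factor c. *)
Lemma t_near_K c m n x : c != 0 -> mK K c ->
  p%:R / c \in O -> (forall i, (f - 'X^q)`_i / c \in O) ->
  x \in O -> (t (m + n) - iota x) / iota c \in Obar ->
  exists2 y, y \in O & (t n - iota y) / iota c ^+ m.+1 \in Obar.
Proof.
move=> c0 cM pc fc xO; elim: m n => [|m IHm] n txO; first by exists x.
have [|y yO tyO] := IHm n.+1; first by rewrite addnS.
exists f.[y]; first exact: integral_closure_horner.
rewrite -t_step -horner_map; apply: fbar_contraction => //.
by rewrite iota_integral.
Qed.

Lemma t_in_K n : exists x : K, t n = iota x.
Proof.
apply: approximable_in_K => j; set e := \dim {:K}.
(* As p divides c^e, descending e j steps yields a precision of at least p^j, with one factor c to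
   spare. *)
have [x xO /asboolP[d [d0 dM txd]]] := t_residue (e * j + n).
have [z|c [c0 cM cdvd]] :=
    mK_common_divisor mK_add (s := d :: p%:R :: (f - 'X^q)).
  rewrite !inE => /or3P[/eqP->|/eqP->|/(nthP 0)[i _ <-]] //.
  exact: mK_natp.
have dc : d / c \in O by rewrite cdvd ?mem_head.
have pc : p%:R / c \in O by rewrite cdvd // !inE eqxx orbT.
have fc i : (f - 'X^q)`_i / c \in O.
  have [iq|iq] := ltnP i (size (f - 'X^q)).
    by rewrite cdvd // !inE mem_nth // !orbT.
  by rewrite nth_default // mul0r rpred0.
have [|y yO tyO] := t_near_K c0 cM pc fc xO (m := (e * j)%N) (n := n).
  have -> : (t (e * j + n) - iota x) / iota c =
      (t (e * j + n) - iota x) / iota d * iota (d / c).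
    by rewrite fmorph_div mulrA divfK ?fmorph_eq0.
  by rewrite rpredM // iota_integral.
exists y.
have C0 : iota c != 0 by rewrite fmorph_eq0.
have -> : (t n - iota y) / p%:R ^+ j = (t n - iota y) / iota c ^+ (e * j).+1 *
    (iota c * iota ((c ^+ e / p%:R) ^+ j)).
  rewrite exprMn -exprM exprVn rmorphM fmorphV !rmorphXn rmorph_nat.
  rewrite (mulrA (iota c)) -exprS mulrA divfK //.
  by rewrite expf_neq0.
have cO : iota c \in Obar by rewrite iota_integral mK_integral.
rewrite (rpredM tyO) // (rpredM cO) // iota_integral rpredX //.
exact: natp_dvd_mK_exp.
Qed.

End Dynamics.
End AlgebraicClosure.

Theorem proposition5p2 (p : nat) (p_pr : prime p)
    (K : fieldExtType (padic p_pr))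
    (Kbar : closedFieldType) (iota : {rmorphism K -> Kbar})
    (Kbar_closure : is_algebraic_closure iota)
    (f : {poly K}) (q a : nat) (t0 : K) (t : nat -> Kbar) :
  (forall i, OK K f`_i) ->
  f \is monic ->
  (2 <= (size f).-1)%N ->
  (1 <= a)%N -> q = (p ^ a)%N ->
  (forall i, mK K (f - 'X^q)`_i) ->
  OK K t0 ->
  t 0%N = iota t0 ->
  (forall n, (map_poly iota f).[t n.+1] = t n) ->
  (forall n, unramified iota (adjoin iota (t n))) ->
  (forall n, exists x : K, t n = iota x) /\
  \bigcup_n adjoin iota (t n) = range iota.
Proof.
move=> f_int f_monic f_size a_gt0 -> f_mod /OKE t0_int t0E t_step t_unr.
have f_integral i := (OKE _).1 (f_int i).
have f_size1 : (1 < size f)%N by rewrite (leq_trans f_size) ?leq_pred.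
(* The hypothesis at n = 0 makes O_K local, on which the valuation ring arguments rest. *)
have mK_add x y := mK_add_unramified (x := x) (y := y) (t_unr 0).
have tK n := t_in_K Kbar_closure mK_add f_integral a_gt0 f_mod f_monic f_size1
  t_step t0_int t0E t_unr n.
split=> //; apply/seteqP; split=> [y [n _]|_ [x _ <-]]; last first.
  by exists 0 => //; apply: adjoin_iota.
by have [x ->] := tK n; case/adjoin_in_K => z ->; exists z.
Qed.
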